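(* Let $p$ be a prime, let $\alpha$ be a positive integer, $l,n\in\{0,1,2,\ldots\}$ and $r\in\mathbb{Z}$. Then $$\frac{1}{\lfloor n/p^{\alpha-1}\rfloor!}\sum_{k\equiv r\ (\mathrm{mod}\ p^\alpha)}(-1)^k\binom{pn}{pk}\left(\frac{k-r}{p^{\alpha-1}}\right)^l\equiv\frac{1}{\lfloor n/p^{\alpha-1}\rfloor!}\sum_{k\equiv r\ (\mathrm{mod}\ p^\alpha)}(-1)^k\binom{n}{k}\left(\frac{k-r}{p^{\alpha-1}}\right)^l\pmod{p^{a_p}},$$ where $a_p=1$ if $p=2$, $a_p=2$ if $p=3$, and $a_p=3$ if $p>3$.
   Context: The sums run over all integers $k\equiv r\pmod{p^\alpha}$, with binomial coefficients $\binom{N}{K}=0$ unless $0\le K\le N$; the convention $0^0=1$ is used. Both sides are rational numbers, and the congruence modulo $p^{a_p}$ means that their difference is a rational number lying in $p^{a_p}\mathbb{Z}_p$ (the ring of $p$-adic integers). *)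

(* Defs.v *)
From mathcomp Require Export all_boot all_order all_algebra.

Set Implicit Arguments.
Unset Strict Implicit.
Unset Printing Implicit Defensive.

Import Order.TTheory GRing.Theory Num.Theory.
Local Open Scope ring_scope.

(* A rational number lies in the ring Z_p of p-adic integers (p prime) iff
   p does not divide its reduced denominator. *)
Definition padic_int (p : nat) (x : rat) : bool := ~~ (p%:Z %| denq x)%Z.

(* x = y mod p^a for rationals, i.e. x - y lies in p^a Z_p; the cofactor z is
   automatically rational. *)
Definition padic_congr (p a : nat) (x y : rat) : Prop :=
  exists2 z : rat, padic_int p z & x - y = p%:R ^+ a * z.

Definition a_exp (p : nat) : nat :=
  if p == 2%N then 1%N else if p == 3%N then 2%N else 3%N.

(* Main.v *)
(** Write [<F, P>] for the sum of [P_k F(k)] over the coefficients [P_k] of an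
    integer polynomial [P], let [q = p^(alpha-1)], and let [F(k)] be
    [((k-r)/q)^l] if [k = r] modulo [pq] and [0] otherwise.

    First, [(n/q)!] divides [<F, (1-X)^n Q>] p-adically for all [n] and [Q].
    For [q = 1] and [l = 0] this is Fleck's congruence, which follows from
    [(1-X)^p = p (1-X) U] modulo [1 - X^p]; multiplying [F] by [k - r] amounts
    to applying [X d/dX - r] to the polynomial, which preserves the property.  For
    general [q], expand [(1-X)^(qN) = ((1-X^q) + p U)^N] and use that
    [N!] divides [C(N,j) p^j (N-j)!] p-adically.

    Next write [(1+Y)^p = 1 + Y^p + p w(Y)] and extract from
    [(1+Y)^(pn) = (1 + Y^p + p w)^n] the monomials whose exponents are multiples
    of [p].  With [D] denoting this extraction, the polynomial with coefficients
    [C(pn,pk)] is the sum over [j] of [C(n,j) p^j D(w^j) (1+X)^(n-j)].  The term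
    [j = 0] is [(1+X)^n], the term [j = 1] vanishes, and [p] divides [D(w^2)]
    for [p > 3] by Wolstenholme; in the other terms [p^j/j!] supplies the power of
    [p], because [(n/q)!] divides [j! C(n,j) ((n-j)/q)!]. *)

From HB Require Import structures.
Require Import Defs.
From mathcomp Require Import all_boot all_order all_algebra.
From mathcomp Require Import zify ring.

Import Order.TTheory GRing.Theory Num.Theory.
Local Open Scope ring_scope.

(** * Factorials and p-parts *)

Lemma logn_fact_le (p n : nat) : prime p -> (0 < n)%N ->
  ((p.-1 * logn p n`!).+1 <= n)%N.
Proof.
move=> pp n_gt0; rewrite logn_fact // -addn1.
suff H m : (p.-1 * (\sum_(1 <= k < m.+1) n %/ p ^ k)
            + maxn 1 (n %/ p ^ m) <= n)%N.
  by apply: leq_trans (H n); rewrite leq_add2l leq_maxl.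
elim: m => [|m IH]; first by rewrite big_geq // expn0 divn1 muln0 add0n; lia.
rewrite big_nat_recr //=; apply: leq_trans IH.
rewrite expnSr divnMA; have := leq_trunc_div (n %/ p ^ m) p.
have := prime_gt1 pp.
move: (\sum_(1 <= _ < _) _)%N (n %/ p ^ m)%N => S f; move: (f %/ p)%N => g.
case: p {pp} => // p _ /=; nia.
Qed.

Lemma fact_part_dvdn_exp (p a j : nat) : prime p -> (logn p j`! + a <= j)%N ->
  (p ^ a * (j`!)`_p %| p ^ j)%N.
Proof. by move=> pp le_j; rewrite p_part -expnD dvdn_exp2l // addnC. Qed.

(** Lowering [n - j] by one changes its quotient by [q] only if [q] divides [n - j]; the lost factor
    [(n - j) / q] then divides the new factor [n - j] of [n ^_ j.+1]. *)
Lemma fact_div_dvdn_ffact (q n j : nat) : (0 < q)%N -> (j <= n)%N ->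
  ((n %/ q)`! %| n ^_ j * ((n - j) %/ q)`!)%N.
Proof.
move=> q_gt0; elim: j => [|j IH] le_jn; first by rewrite ffactn0 mul1n subn0.
apply: dvdn_trans (IH (ltnW le_jn)) _.
rewrite ffactnSr -mulnA dvdn_mul //.
have -> : (n - j = (n - j.+1).+1)%N by rewrite -subSn.
set m := (n - j.+1)%N; rewrite divnS //.
case: (boolP (q %| m.+1)%N) => [q_dvd|_]; last by rewrite add0n dvdn_mull.
rewrite add1n factS; apply: dvdn_mul => //.
have -> : (m %/ q).+1 = (m.+1 %/ q)%N by rewrite divnS // q_dvd.
by rewrite -{2}(divnK q_dvd) dvdn_mulr.
Qed.

(** After multiplication by the p-part of [j!], the binomial becomes [n ^_ j], while [p ^ j] pays
    for both [p ^ a] and that p-part. *)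
Lemma fact_part_dvdn_bin (p q a n j : nat) :
    prime p -> (0 < q)%N -> (j <= n)%N -> (logn p j`! + a <= j)%N ->
  (p ^ a * ((n %/ q)`!)`_p %| 'C(n, j) * p ^ j * (((n - j) %/ q)`!)`_p)%N.
Proof.
move=> pp q_gt0 le_jn le_j.
have Cgt0 : (0 < 'C(n, j))%N by rewrite bin_gt0.
have := fact_div_dvdn_ffact _ _ _ q_gt0 le_jn.
rewrite -bin_ffact => /(@partn_dvd p _ _ _).
rewrite !partnM ?muln_gt0 ?Cgt0 ?fact_gt0 // => /(_ isT) dvd1.
have dvd2 := fact_part_dvdn_exp _ _ _ pp le_j.
rewrite -(@dvdn_pmul2r (j`!)`_p) ?part_gt0 //.
rewrite mulnAC mulnC; apply: dvdn_trans (dvdn_mul dvd1 dvd2) _.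
have Cp := dvdn_part p 'C(n, j).
rewrite (_ : (_ * _ * _ * _)%N = ('C(n, j)`_p *
  (p ^ j * (((n - j) %/ q)`!)`_p * (j`!)`_p))%N); last ring.
by rewrite -!mulnA dvdn_mul // mulnA.
Qed.

(** * Pairing polynomials with sequences *)

Definition pairing (F : nat -> int) (P : {poly int}) : int :=
  \sum_(i < size P) P`_i * F i.

Lemma pairingE (F : nat -> int) (P : {poly int}) (m : nat) :
  (size P <= m)%N -> pairing F P = \sum_(i < m) P`_i * F i.
Proof.
move=> le_m; rewrite /pairing (big_ord_widen m (fun i => P`_i * F i) le_m).
rewrite big_mkcond; apply: eq_bigr => i _; case: ltnP => // le_i.
by rewrite nth_default // mul0r.
Qed.

Fact pairing_is_linear (F : nat -> int) : linear_for *%R (pairing F).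
Proof.
move=> a P Q; pose m := maxn (size P) (size Q).
have leP : (size P <= m)%N := leq_maxl _ _.
have leQ : (size Q <= m)%N := leq_maxr _ _.
have lePQ : (size (a *: P + Q)%R <= m)%N.
  apply: leq_trans (size_polyD _ _) _.
  by rewrite geq_max leQ andbT (leq_trans (size_scale_leq _ _)).
rewrite !(pairingE _ _ m) // mulr_sumr -big_split /=.
by apply: eq_bigr => i _; rewrite coefD coefZ mulrDl mulrA.
Qed.

HB.instance Definition _ (F : nat -> int) :=
  GRing.isLinear.Build int {poly int} int *%R (pairing F) (pairing_is_linear F).

Lemma pairingXn (F : nat -> int) (n : nat) : pairing F 'X^n = F n.
Proof.
rewrite (pairingE _ _ n.+1) ?size_polyXn // big_ord_recr /= coefXn eqxx mul1r.
rewrite big1 ?add0r // => i _; rewrite coefXn.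
by rewrite ltn_eqF ?mul0r.
Qed.

(** Identities between functionals need only be checked on monomials. *)
Lemma pairing_unique (f : {poly int} -> int) (F : nat -> int) :
  linear_for *%R f -> (forall n, f 'X^n = F n) -> f =1 pairing F.
Proof.
move=> f_lin fE; have f0 : f 0 = 0.
  by have := f_lin (-1) 0 0; rewrite scaler0 addr0 mulN1r addNr.
have fsum m (c : nat -> int) :
    f (\sum_(i < m) c i *: 'X^i) = \sum_(i < m) c i * F i.
  elim: m => [|m IH]; first by rewrite !big_ord0.
  by rewrite !big_ord_recr /= addrC f_lin IH fE addrC.
by move=> P; rewrite -{1}(coefK P) poly_def fsum.
Qed.

(* Quantifying over [Q] makes the set of such [P] an ideal. *)
Definition dvd_pairing (F : nat -> int) (m : nat) (P : {poly int}) : Prop :=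
  forall Q, (m%:Z %| pairing F (P * Q))%Z.

Lemma dvd_pairing_self (F : nat -> int) (m : nat) (P : {poly int}) :
  dvd_pairing F m P -> (m%:Z %| pairing F P)%Z.
Proof. by move=> /(_ 1); rewrite mulr1. Qed.

Lemma dvd_pairingMr (F : nat -> int) (m : nat) (P Q : {poly int}) :
  dvd_pairing F m P -> dvd_pairing F m (P * Q).
Proof. by move=> FP Q'; rewrite -mulrA. Qed.

Lemma dvd_pairingMl (F : nat -> int) (m : nat) (P Q : {poly int}) :
  dvd_pairing F m P -> dvd_pairing F m (Q * P).
Proof. by rewrite mulrC; apply: dvd_pairingMr. Qed.

Lemma dvd_pairingD (F : nat -> int) (m : nat) (P Q : {poly int}) :
  dvd_pairing F m P -> dvd_pairing F m Q -> dvd_pairing F m (P + Q).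
Proof.
move=> FP FQ S; rewrite mulrDl linearD.
by apply: rpredD; [exact: FP | exact: FQ].
Qed.

Lemma dvd_pairing_sum (F : nat -> int) (m : nat) (I : finType)
    (P : I -> {poly int}) :
  (forall i, dvd_pairing F m (P i)) -> dvd_pairing F m (\sum_i P i).
Proof.
by move=> FP Q; rewrite mulr_suml linear_sum rpred_sum // => i _; apply: FP.
Qed.

Lemma dvd_pairing_mulrn (F : nat -> int) (m m' c : nat) (P : {poly int}) :
  (m %| c * m')%N -> dvd_pairing F m' P -> dvd_pairing F m (P *+ c).
Proof.
move=> m_dvd FP Q; rewrite mulrnAl linearMn -mulr_natl natz.
by apply: dvdz_trans (dvdz_mul (dvdzz c) (FP Q)); rewrite -PoszM.
Qed.

Lemma dvd_pairing_trans (F : nat -> int) (m m' : nat) (P : {poly int}) :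
  (m %| m')%N -> dvd_pairing F m' P -> dvd_pairing F m P.
Proof. by move=> m_dvd FP Q; apply: dvdz_trans (FP Q). Qed.

Lemma eq_pairing (F G : nat -> int) : F =1 G -> pairing F =1 pairing G.
Proof. by move=> FG P; apply: eq_bigr => i _; rewrite FG. Qed.

Lemma eq_dvd_pairing (F G : nat -> int) (m : nat) (P : {poly int}) :
  F =1 G -> dvd_pairing F m P -> dvd_pairing G m P.
Proof. by move=> FG FP Q; rewrite -(eq_pairing _ _ FG). Qed.

Lemma pairing_mulX_deriv (F : nat -> int) (P : {poly int}) :
  pairing F ('X * P^`()) = pairing (fun k => k%:Z * F k) P.
Proof.
apply: (pairing_unique (fun P => pairing F ('X * P^`()))) => [a Q S|n].
  by rewrite linearP mulrDr -scalerAr linearP.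
 rewrite derivXn mulrnAr -exprS linearMn /= pairingXn -mulr_natl natz.
by case: n => [|n] //=; rewrite !mul0r.
Qed.

Lemma pairing_compNX (F : nat -> int) (P : {poly int}) :
  pairing F (P \Po (- 'X)) = pairing (fun k => (-1) ^+ k * F k) P.
Proof.
apply: (pairing_unique (fun P => pairing F (P \Po (- 'X)))) => [a Q S|n].
  by rewrite !linearP.
by rewrite comp_Xn_poly -scaleN1r exprZn linearZ /= pairingXn.
Qed.

(* Only meaningful for [0 < q]; the bound [size P] is then large enough. *)
Definition decim (q s : nat) (P : {poly int}) : {poly int} :=
  \poly_(i < size P) P`_(q * i + s).

Lemma coef_decim (q s i : nat) (P : {poly int}) :
  (0 < q)%N -> (decim q s P)`_i = P`_(q * i + s).
Proof.
move=> q_gt0; rewrite coef_poly; case: ltnP => // le_i.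
rewrite nth_default //; apply: leq_trans le_i _; nia.
Qed.

Fact decim_is_linear (q s : nat) : linear (decim q.+1 s).
Proof.
by move=> a P Q; apply/polyP => i; rewrite !(coefD, coefZ, coef_decim).
Qed.

HB.instance Definition _ (q s : nat) := GRing.isLinear.Build int {poly int}
  {poly int} _ (decim q.+1 s) (decim_is_linear q s).

Lemma decim_mulXn (q s : nat) (P : {poly int}) : (s < q)%N ->
  decim q s (P * 'X^q) = decim q s P * 'X.
Proof.
move=> lt_sq; have q_gt0 : (0 < q)%N by lia.
apply/polyP => i; rewrite coefMX !coef_decim // coefMXn.
case: i => [|i]; first by rewrite muln0 add0n lt_sq.
by rewrite ifN; [congr (P`_ _); lia | rewrite -leqNgt; nia].
Qed.

Lemma decim_mul_exp (q s j : nat) (c : int) (P : {poly int}) : (s < q)%N ->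
  decim q s (P * (1 + c *: 'X^q) ^+ j) = decim q s P * (1 + c *: 'X) ^+ j.
Proof.
move=> lt_sq; elim: j P => [|j IH] P; first by rewrite !expr0 !mulr1.
rewrite exprS mulrA IH exprS mulrA; congr (_ * _).
case: q lt_sq => // q lt_sq in IH *.
by rewrite !mulrDr !mulr1 -!scalerAr linearD linearZ /= decim_mulXn.
Qed.

Lemma pairing_decim (q s : nat) (F : nat -> int) (P : {poly int}) : (s < q)%N ->
  pairing F (decim q s P) =
    pairing (fun k => if (k %% q == s)%N then F (k %/ q)%N else 0) P.
Proof.
case: q => // q lt_sq.
apply: (pairing_unique (fun P => pairing F (decim q.+1 s P))) => [a Q S|n].
  by rewrite !linearP.
case: eqP => [<-|neq].
  rewrite (_ : decim _ _ _ = 'X^(n %/ q.+1)) ?pairingXn //.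
  apply/polyP => i; rewrite coef_decim // !coefXn; congr (nat_of_bool _)%:R.
  by rewrite {2}(divn_eq n q.+1) mulnC eqn_add2r eqn_pmul2r.
rewrite (_ : decim _ _ _ = 0) ?linear0 //.
apply/polyP => i; rewrite coef_decim // coefXn coef0; case: eqP => // n_eq.
by case: neq; rewrite -n_eq mulnC modnMDl modn_small.
Qed.

(** * Divisibility by factorials *)

Lemma exprD_prime (R : comNzRingType) (p : nat) (x y : R) : prime p ->
  exists z, (x + y) ^+ p = x ^+ p + y ^+ p + z *+ p.
Proof.
case: p => // p pp.
exists (\sum_(i < p) x ^+ (p - i) * y ^+ i.+1 *+ ('C(p.+1, i.+1) %/ p.+1)).
rewrite exprDn big_ord_recl big_ord_recr /= subnn bin0 binn !mulr1n expr0 mul1r.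
rewrite subn0 mulr1 -addrA; congr (_ + _); rewrite addrC; congr (_ + _).
rewrite -sumrMnl; apply: eq_bigr => i _.
rewrite /bump /= add1n subSS -mulrnA divnK //.
by rewrite prime_dvd_bin // !ltnS leq0n ltn_ord.
Qed.

Lemma expr1BX_prime (p b : nat) : prime p ->
  exists U : {poly int}, (1 - 'X) ^+ (p ^ b) = (1 - 'X^(p ^ b)) + U *+ p.
Proof.
move=> pp; elim: b => [|b [U IH]].
  by exists 0; rewrite expn0 !expr1 mul0rn addr0.
set q := (p ^ b)%N in IH *.
have [Z1 e1] := exprD_prime _ _ (1 - 'X^q) (U *+ p) pp.
have [Z2 e2] := exprD_prime _ _ (1 : {poly int}) (- 'X^q) pp.
(* For [p = 2] the sign is corrected by adding [2 X^(2q)]. *)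
have [Z3 e3] : exists Z : {poly int}, (- 'X^q) ^+ p = - ('X^q) ^+ p + Z *+ p.
  rewrite exprNn; case: (even_prime pp) => [->|p_odd].
    by exists ('X^q ^+ 2); rewrite sqrrN expr1n mul1r mulr2n addKr.
  by exists 0; rewrite -signr_odd p_odd mulN1r mul0rn addr0.
have [Z4 e4] : exists Z : {poly int}, (U *+ p) ^+ p = Z *+ p.
  by exists ((U *+ p) ^+ p.-1 * U); rewrite -mulrnAr -exprSr prednK ?prime_gt0.
exists (Z1 + Z2 + Z3 + Z4).
rewrite expnSr exprM IH e1 e2 e3 e4 expr1n -exprM !mulrnDl; ring.
Qed.

(** Evaluating at 1 gives [0 = p U(1)], so [1 - X] divides the remainder [U]. *)
Lemma expr1BX_prime_factor (p : nat) : prime p ->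
  exists U : {poly int}, (1 - 'X) ^+ p = (1 - 'X^p) + ((1 - 'X) * U) *+ p.
Proof.
move=> pp; have [U] := expr1BX_prime p 1 pp; rewrite expn1 => eU.
have p_gt0 := prime_gt0 pp.
have /factor_theorem [V eV] : root U 1.
  have := congr1 (horner^~ 1) eU.
  rewrite /root !(hornerE, hornerMn) expr1n subrr.
  rewrite expr0n gtn_eqF // add0r => /esym /eqP.
  by rewrite mulrn_eq0 gtn_eqF.
by exists (- V); rewrite eU eV mulrN -mulNr opprB polyC1 mulrC.
Qed.

Lemma dvd_pairing_periodic (p : nat) (F : nat -> int) (j : nat) : prime p ->
    (forall k, F (k + p)%N = F k) ->
  dvd_pairing F (j`!)`_p ((1 - 'X) ^+ j).
Proof.
move=> pp Fper; have [U eU] := expr1BX_prime_factor p pp.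
(* Divisibility by 0 means that [1 - X^p] annihilates [F], which is periodicity. *)
have F0 : dvd_pairing F 0 (1 - 'X^p).
  move=> Q; rewrite dvd0z mulrBl mul1r linearB subr_eq0 /= eq_sym; apply/eqP.
  apply: (pairing_unique (fun P => pairing F ('X^p * P))) => [a R S|n].
    by rewrite mulrDr -scalerAr linearP.
  by rewrite -exprD pairingXn addnC.
(* Each further factor (1-X)^(p-1) gains a factor p. *)
have fleck i : dvd_pairing F (p ^ i) ((1 - 'X) ^+ (p.-1 * i).+1).
  elim: i => [|i IH]; first by move=> Q; rewrite expn0 dvd1z.
  have -> : ((p.-1 * i.+1).+1 = p.-1 * i + p)%N.
    by have := prime_gt0 pp; nia.
  rewrite exprD eU mulrDr; apply: dvd_pairingD.
    by apply: dvd_pairingMl; apply: dvd_pairing_trans F0.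
  rewrite mulrnAr mulrA -exprSr.
  apply: dvd_pairing_mulrn (dvd_pairingMr _ _ _ _ IH).
  by rewrite expnS.
case: j => [|j]; first by move=> Q; rewrite fact0 partn1 dvd1z.
rewrite p_part; have := logn_fact_le p j.+1 pp isT; move: (logn _ _) => i le_i.
by rewrite -(subnK le_i) exprD; apply: dvd_pairingMl.
Qed.

(** The derivative of [(1 - X)^j] loses a factor [1 - X] but brings out [j], and [j! = j (j-1)!]. *)
Lemma dvd_pairing_mul_affine (p : nat) (F : nat -> int) (c : int) :
    (forall j, dvd_pairing F (j`!)`_p ((1 - 'X) ^+ j)) ->
  forall j, dvd_pairing (fun k => (k%:Z + c) * F k) (j`!)`_p ((1 - 'X) ^+ j).
Proof.
move=> FP j Q.
have -> : pairing (fun k => (k%:Z + c) * F k) ((1 - 'X) ^+ j * Q) =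
  pairing F ('X * ((1 - 'X) ^+ j * Q)^`()) + c * pairing F ((1 - 'X) ^+ j * Q).
  rewrite pairing_mulX_deriv /pairing mulr_sumr -big_split /=.
  by apply: eq_bigr => i _; ring.
rewrite rpredD ?dvdz_mull //; last exact: FP.
rewrite derivM deriv_exp mulrDr linearD /= rpredD //; last first.
  by rewrite mulrCA; apply: FP.
rewrite mulrnAl mulrnAr; set P := 'X * _.
have -> : P *+ j = (1 - 'X) ^+ j.-1 *+ j * ((1 - 'X)^`() * Q * 'X).
  by rewrite mulrnAl; congr (_ *+ _); rewrite /P; ring.
apply: dvd_pairing_mulrn (FP _) _.
case: j {P} => [|j]; first by rewrite mul0n dvdn0.
by rewrite /= factS partnM ?fact_gt0 // dvdn_mul // dvdn_part.
Qed.
Lemma dvd_pairing_arith_prog (p b s n : nat) (F : nat -> int) :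
    prime p -> (s < p ^ b)%N ->
    (forall j, dvd_pairing F (j`!)`_p ((1 - 'X) ^+ j)) ->
  dvd_pairing (fun k => if (k %% p ^ b == s)%N then F (k %/ p ^ b)%N else 0)
    ((n %/ p ^ b)`!)`_p ((1 - 'X) ^+ n).
Proof.
move=> pp lt_s FP; have [U] := expr1BX_prime p b pp.
set q := (p ^ b)%N in lt_s *; set G := (fun k => _) => eU.
(* Decimation by [q] turns [1 - X^q] into [1 - X], where the hypothesis applies. *)
have GP j : dvd_pairing G (j`!)`_p ((1 - 'X^q) ^+ j).
  move=> Q; rewrite -pairing_decim // mulrC -scaleN1r decim_mul_exp //.
  by rewrite scaleN1r mulrC; apply: FP.
rewrite {2}(divn_eq n q) exprD mulnC exprM eU exprDn.
apply: dvd_pairingMr; apply: dvd_pairing_sum => -[i /=]; rewrite ltnS => le_i.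
rewrite exprMn_n mulrnAr -mulrnA.
apply: dvd_pairing_mulrn (dvd_pairingMr _ _ _ _ (GP _)).
have le_v : (logn p i`! + 0 <= i)%N.
  case: i {le_i} => [|i]; first by rewrite fact0 logn1.
  have := logn_fact_le p i.+1 pp isT; have := prime_gt1 pp; nia.
have := fact_part_dvdn_bin p 1 0 (n %/ q) i pp isT le_i le_v.
by rewrite !divn1 expn0 mul1n [('C(_, _) * _)%N]mulnC.
Qed.

(** * The decimated binomial expansion *)

(* [((1 + X)^p - 1 - X^p) / p] for prime [p]. *)
Definition binom_rest (p : nat) : {poly int} :=
  \poly_(i < p) (if i == 0%N then 0 else ('C(p, i) %/ p)%N%:Z).

Lemma coef_expr1DX (n i : nat) : ((1 + 'X : {poly int}) ^+ n)`_i = 'C(n, i)%:Z.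
Proof.
have -> : (1 + 'X : {poly int}) ^+ n = \poly_(i < n.+1) 'C(n, i)%:Z.
  rewrite exprDn poly_def; apply: eq_bigr => j _.
  by rewrite expr1n mul1r -scaler_nat natz.
by rewrite coef_poly; case: ltnP => // lt_i; rewrite bin_small.
Qed.

Lemma expr1DX_prime (p : nat) : prime p ->
  (1 + 'X) ^+ p = (1 + 'X^p) + binom_rest p *+ p.
Proof.
move=> pp; have p_gt0 := prime_gt0 pp.
apply/polyP => i; rewrite coef_expr1DX !coefD coef1 coefXn coefMn coef_poly.
case: (ltngtP i p) => [lt_ip|lt_pi|->].
- case: eqP => [->|/eqP i_neq0]; first by rewrite bin0 mul0rn !addr0.
  rewrite !add0r -mulr_natr natz -PoszM divnK // prime_dvd_bin //.
  by rewrite lt0n i_neq0.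
- by rewrite bin_small // gtn_eqF ?(leq_trans _ lt_pi) // mul0rn !addr0.
- by rewrite binn gtn_eqF // add0r mul0rn addr0.
Qed.

Lemma decim_expr1DX (p n : nat) : prime p ->
  decim p 0 ((1 + 'X) ^+ (p * n)) =
  \sum_(j < n.+1)
    (decim p 0 (binom_rest p ^+ j) * (1 + 'X) ^+ (n - j)) *+ ('C(n, j) * p ^ j).
Proof.
move=> pp; rewrite exprM expr1DX_prime // exprDn.
case: p pp => // p pp; rewrite linear_sum; apply: eq_bigr => j _ /=.
rewrite linearMn exprMn_n mulrnAr linearMn -mulrnA mulnC mulrC /=.
congr (_ *+ _).
by have := decim_mul_exp p.+1 0 (n - j) 1; rewrite !scale1r => ->.
Qed.

(** By Pascal's rule, [C(p-1, j) + C(p-1, j+1) = C(p, j+1)] vanishes modulo [p] for [j + 1 < p], so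
    the sign alternates. *)
Lemma bin_pred_prime (p j : nat) : prime p -> (j < p)%N ->
  'C(p.-1, j)%:R = (-1) ^+ j :> 'F_p.
Proof.
move=> pp; elim: j => [|j IH] lt_jp; first by rewrite bin0.
have := prime_dvd_bin pp (k := j.+1); rewrite lt_jp => /(_ isT).
rewrite -{2}(prednK (prime_gt0 pp)) binS (dvdn_pcharf (pchar_Fp pp)) natrD.
rewrite (IH (ltnW lt_jp)) addr_eq0 => /eqP ->.
by rewrite exprS mulN1r.
Qed.

(** For [x] nonzero, [C(p, x) / p = C(p-1, x-1) / x], which is [1/x] up to sign; at 0 both sides
    vanish as [0^-1 = 0]. *)
Lemma binom_rest_sqr (p : nat) (x : 'F_p) : prime p ->
  ((binom_rest p)`_x)%:~R ^+ 2 = (x ^+ 2)^-1 :> 'F_p.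
Proof.
move=> pp; have p_gt0 := prime_gt0 pp.
have lt_xp : (x < p)%N by rewrite -{2}(Fp_cast pp).
have xE : x%:R = x :> 'F_p by rewrite natr_Zp.
rewrite coef_poly lt_xp; case: eqP => [x0|/eqP x0].
  by rewrite -xE x0 !expr0n /= invr0.
have e : (x * ('C(p, x) %/ p) = 'C(p.-1, x.-1))%N.
  apply/eqP; rewrite -(eqn_pmul2l p_gt0) mul_bin_diag prednK ?lt0n //.
  by rewrite mulnCA [(p * _)%N]mulnC divnK // prime_dvd_bin // lt0n x0.
have : (x * ('C(p, x) %/ p)%:R) ^+ 2 = 1 :> 'F_p.
  rewrite -{1}xE -natrM e bin_pred_prime // ?sqrr_sign //.
  by apply: leq_ltn_trans lt_xp; apply: leq_pred.
rewrite exprMn pmulrn; move: (_%:~R ^+ 2) => y xy.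
by apply: (mulfI (_ : x ^+ 2 != 0)); rewrite ?xy ?mulfV //; apply/eqP => x20;
  move: xy; rewrite x20 mul0r => /eqP; rewrite eq_sym oner_eq0.
Qed.

(** The substitution [x -> 2x] gives [4 S = S], and 3 is invertible. *)
Lemma sum_inv_sqr_Fp (p : nat) : prime p -> (3 < p)%N ->
  \sum_(x : 'F_p) (x ^+ 2)^-1 = 0.
Proof.
move=> pp p_gt3.
have nz k : (0 < k < p)%N -> k%:R != 0 :> 'F_p.
  move=> /andP[k_gt0 lt_kp]; rewrite -(dvdn_pcharf (pchar_Fp pp)).
  by rewrite gtnNdvd.
have n2 := nz 2%N (ltnW p_gt3); have n3 := nz 3%N p_gt3.
set S := \sum_x _.
have eS : 2%:R ^+ 2 * S = S.
  rewrite {1}/S (reindex_inj (mulfI n2)) mulr_sumr; apply: eq_bigr => x _ /=.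
  by rewrite exprMn invfM mulVKf // expf_neq0.
have : 3%:R * S = 0.
  have -> : 3%:R * S = 2%:R ^+ 2 * S - S by ring.
  by rewrite eS subrr.
by move/eqP; rewrite mulf_eq0 (negPf n3) => /eqP.
Qed.

(** The coefficients of [w] are symmetric under [i -> p - i], so that of [X^p] in [w^2] is the sum
    of the squares [w_i^2], each [1/i^2] modulo [p]. *)
Lemma binom_rest_sqr_coefp (p : nat) : prime p -> (3 < p)%N ->
  (p%:Z %| (binom_rest p ^+ 2)`_p)%Z.
Proof.
move=> pp p_gt3; rewrite (dvdz_pcharf (pchar_Fp pp)) expr2 coefM rmorph_sum /=.
set w := binom_rest p; have w0 : w`_0 = 0 by rewrite coef_poly if_same.
rewrite big_ord_recr /= subnn w0 mulr0 addr0.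
(* ['F_p] is an ordinal type whose bound is only provably equal to [p]. *)
have reidx m (g : nat -> 'F_p) : m = p -> \sum_(i < p) g i = \sum_(i < m) g i.
  by move=> ->.
rewrite (reidx _ (fun i => (w`_i * w`_(p - i))%:~R) (Fp_cast pp)).
apply/eqP; rewrite -[RHS](sum_inv_sqr_Fp p pp p_gt3); apply: eq_bigr => x _.
rewrite -binom_rest_sqr // rmorphM expr2 /=.
have lt_xp : (x < p)%N by rewrite -{2}(Fp_cast pp).
have [->|x0] := eqVneq (x : nat) 0%N; first by rewrite w0 !mul0r.
congr (_ * _%:~R); rewrite !coef_poly lt_xp (negPf x0) ifT; last first.
  by rewrite ltn_subrL lt0n x0 prime_gt0.
by rewrite subn_eq0 leqNgt lt_xp /= bin_sub // ltnW.
Qed.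

Lemma decim_binom_rest (p : nat) : (0 < p)%N -> decim p 0 (binom_rest p) = 0.
Proof.
move=> p_gt0; apply/polyP => i; rewrite coef_decim // addn0 coef_poly coef0.
case: i => [|i]; first by rewrite muln0 if_same.
by rewrite ifN // -leqNgt leq_pmulr.
Qed.

(** As [w] has degree below [p] and no constant term, only the monomial [X^p] of [w^2] can
    survive. *)
Lemma decim_binom_rest_sqr (p : nat) : prime p -> (3 < p)%N ->
  exists V : {poly int}, decim p 0 (binom_rest p ^+ 2) = V *+ p.
Proof.
move=> pp p_gt3; have p_gt0 := prime_gt0 pp.
have /dvdzP[c ec] := binom_rest_sqr_coefp p pp p_gt3.
exists (c *: 'X); apply/polyP => i.
rewrite coef_decim // addn0 coefMn coefZ coefX.
case: i => [|[|i]].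
- rewrite muln0 mulr0 mul0rn expr2 coefM big_ord1 /= coef_poly if_same mul0r //.
- by rewrite muln1 ec mulr1 -mulr_natr natz.
- rewrite mulr0 mul0rn nth_default // expr2.
  apply: leq_trans (size_polyMleq _ _) _.
  have : (size (binom_rest p) <= p)%N by apply: size_poly.
  by move: (size _) => m; nia.
Qed.

Lemma dvd_pairing_decim_sub (p q n : nat) (F : nat -> int) :
    prime p -> (0 < q)%N ->
    (forall m, dvd_pairing F ((m %/ q)`!)`_p ((1 + 'X) ^+ m)) ->
  dvd_pairing F (p ^ a_exp p * ((n %/ q)`!)`_p)
    (decim p 0 ((1 + 'X) ^+ (p * n)) - (1 + 'X) ^+ n).
Proof.
move=> pp q_gt0 FP; have p_gt0 := prime_gt0 pp.
rewrite decim_expr1DX // big_ord_recl /= bin0 expn0 muln1 mulr1n expr0 subn0.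
have -> : decim p 0 1 = 1.
  apply/polyP => i; rewrite coef_decim // addn0 !coef1.
  by rewrite muln_eq0 gtn_eqF.
rewrite mul1r addrAC subrr add0r; apply: dvd_pairing_sum => -[j /= lt_jn].
rewrite /bump /= add1n.
case: j lt_jn => [|j] lt_jn.
  rewrite expr1 decim_binom_rest // mul0r mul0rn => Q.
  by rewrite mul0r linear0 dvdz0.
have := logn_fact_le p j.+2 pp isT; set v := logn _ _ => le_v.
(* [j] is offset by 2. At index 2 with [p > 3], [p^2 / 2!] yields only [p^2]; Wolstenholme supplies
   the third factor. *)
have [/andP[/eqP j0 p_gt3]|small] := boolP ((j == 0%N) && (3 < p)%N).
  have [V eV] := decim_binom_rest_sqr p pp p_gt3.
  rewrite j0 eV mulrnAl -mulrnA.
  apply: dvd_pairing_mulrn (dvd_pairingMl _ _ _ _ (FP _)).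
  have le2 : (logn p 2`! + 2 <= 2)%N by rewrite /v j0 in le_v; nia.
  have := fact_part_dvdn_bin p q 2 n 2 pp q_gt0 _ le2; rewrite j0 in lt_jn.
  move=> /(_ lt_jn) /(dvdn_mul (dvdnn p)).
  by rewrite /a_exp !gtn_eqF // ?(ltnW p_gt3) // mulnA -expnS mulnA.
apply: dvd_pairing_mulrn (dvd_pairingMl _ _ _ _ (FP _)).
apply: fact_part_dvdn_bin => //; rewrite -/v /a_exp.
(* It remains that [v + a_exp p <= j + 2]; this follows from [(p-1) v + 1 <= j + 2], with [j > 0]
   when [p > 3]. *)
have := prime_gt1 pp; move: v small le_v => {lt_jn FP pp p_gt0} v.
by case: (p =P 2%N) => [->|p2]; [nia | case: (p =P 3%N) => [->|p3]; nia].
Qed.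

(** * Integrality and the return to rational sums *)

Lemma padic_int_div (p m : nat) (c : int) : (0 < m)%N -> ~~ (p %| m)%N ->
  padic_int p (c%:~R / m%:R).
Proof.
move=> m_gt0; apply: contra => p_dvd; set z := c%:~R / m%:R in p_dvd.
have m_neq0 : m%:R != 0 :> rat by rewrite pnatr_eq0 -lt0n.
have e : numq z * m%:Z = c * denq z.
  apply: (@intr_inj rat); rewrite !rmorphM /= numqE /z -pmulrn.
  by rewrite mulrAC divfK.
have : (denq z %| numq z * m%:Z)%Z by rewrite e dvdz_mull.
rewrite Gauss_dvdzr; last by rewrite coprimez_sym; apply: coprime_num_den.
by move/(dvdz_trans p_dvd).
Qed.

(** Write [r = t q + s] with [0 <= s < q]. With [k / q] rounded down, [k = r] modulo [p q] iff
    [k = s] modulo [q] and [k / q = t] modulo [p]; then [(k - r) / q] is [k / q - t]. *)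
Lemma dvd_pairing_residue_power (p b l n : nat) (r : int) : prime p ->
  dvd_pairing (fun k => if (k%:Z == r %[mod (p ^ b.+1)%N%:Z])%Z
                        then ((k%:Z - r) %/ (p ^ b)%N%:Z)%Z ^+ l else 0)
    ((n %/ p ^ b)`!)`_p ((1 - 'X) ^+ n).
Proof.
move=> pp; set q := (p ^ b)%N.
have q_gt0 : (0 < q)%N by rewrite expn_gt0 prime_gt0.
have q_neq0 : q%:Z != 0 by rewrite eqz_nat -lt0n.
pose t := (r %/ q%:Z)%Z; pose s := `|(r %% q%:Z)%Z|%N.
have sE : s%:Z = (r %% q%:Z)%Z by rewrite /s gez0_abs // modz_ge0.
have lt_sq : (s < q)%N by rewrite -ltz_nat sE ltz_pmod.
have rE : r = t * q%:Z + s%:Z by rewrite sE -divz_eq.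
pose G (k : nat) := if (p%:Z %| k%:Z - t)%Z then (k%:Z - t) ^+ l else 0.
have GP j : dvd_pairing G (j`!)`_p ((1 - 'X) ^+ j).
  (* Fleck's case [l = 0], then one affine multiplication per power. *)
  rewrite /G; elim: l j {G} => [|l IH] j.
    apply: dvd_pairing_periodic => // k.
    by rewrite !expr0 PoszD addrAC rpredDr // dvdzz.
  apply: eq_dvd_pairing (dvd_pairing_mul_affine p _ (- t) IH j) => k /=.
  by case: ifP => _; rewrite ?mulr0 // exprS.
apply: eq_dvd_pairing (dvd_pairing_arith_prog p b s n G pp lt_sq GP) => k /=.
rewrite -/q eqz_mod_dvd expnSr -/q PoszM.
have kE : k%:Z - r = q%:Z * ((k %/ q)%N%:Z - t) + ((k %% q)%N%:Z - s%:Z).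
  by rewrite {1}(divn_eq k q) PoszD PoszM rE; ring.
case: eqP => [ks|ks].
  by rewrite kE ks subrr addr0 dvdz_mul2l // /G mulKz.
rewrite ifN //; apply/negP => dvd_pq; case: ks.
have : (q%:Z %| k%:Z - r)%Z by apply: dvdz_trans dvd_pq; rewrite dvdz_mulr.
by rewrite -eqz_mod_dvd -sE modz_nat eqz_nat => /eqP.
Qed.

(** On the residue class [k - r] is a multiple of [p ^ b], so integer and rational quotients
    agree. *)
Lemma pairing_sum_rat (p b l n : nat) (r : int) (P : {poly int}) : prime p ->
    (size P <= n.+1)%N ->
  \sum_(0 <= k < n.+1 | (k%:Z == r %[mod (p ^ b.+1)%N%:Z])%Z)
    (-1) ^+ k * (P`_k)%:~R * ((k%:Z - r)%:~R / (p ^ b)%N%:R) ^+ l =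
  (pairing (fun k => (-1) ^+ k *
     if (k%:Z == r %[mod (p ^ b.+1)%N%:Z])%Z
     then ((k%:Z - r) %/ (p ^ b)%N%:Z)%Z ^+ l else 0) P)%:~R :> rat.
Proof.
move=> pp le_P; rewrite (pairingE _ _ _ le_P).
rewrite rmorph_sum /= big_mkcond big_mkord.
apply: eq_bigr => k _; case: ifP => [k_eq|_]; last by rewrite !mulr0.
rewrite !rmorphM rmorphXn rmorph_sign mulrCA mulrA /=; congr (_ * _ ^+ _).
have q_neq0 : (p ^ b)%N%:R != 0 :> rat.
  by rewrite pnatr_eq0 -lt0n expn_gt0 prime_gt0.
apply: (canLR (mulfK q_neq0)); rewrite pmulrn -rmorphM /= divzK //.
by rewrite -eqz_mod_dvd; move: k_eq; rewrite !eqz_mod_dvd; apply: dvdz_trans;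
  rewrite expnSr PoszM dvdz_mulr.
Qed.

(* All integers k outside 0..n contribute 0 to both sums, since then
   neither 0 <= k <= n nor 0 <= pk <= pn. *)
Theorem theorem1p3 (p alpha l n : nat) (r : int)
    (hp : prime p) (halpha : (0 < alpha)%N) :
  padic_congr p (a_exp p)
    (((n %/ p ^ (alpha - 1))`!)%:R^-1 *
      \sum_(0 <= k < n.+1 | (k%:Z == r %[mod (p ^ alpha)%N%:Z])%Z)
        (-1) ^+ k * 'C(p * n, p * k)%:R *
        ((k%:Z - r)%:~R / (p ^ (alpha - 1))%N%:R) ^+ l)
    (((n %/ p ^ (alpha - 1))`!)%:R^-1 *
      \sum_(0 <= k < n.+1 | (k%:Z == r %[mod (p ^ alpha)%N%:Z])%Z)
        (-1) ^+ k * 'C(n, k)%:R *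
        ((k%:Z - r)%:~R / (p ^ (alpha - 1))%N%:R) ^+ l).
Proof.
case: alpha halpha => // b _; rewrite subSS subn0.
have p_gt0 := prime_gt0 hp.
set F := fun k : nat => if (k%:Z == r %[mod (p ^ b.+1)%N%:Z])%Z
  then ((k%:Z - r) %/ (p ^ b)%N%:Z)%Z ^+ l else 0.
pose G k := (-1) ^+ k * F k.
pose A : {poly int} := decim p 0 ((1 + 'X) ^+ (p * n)).
have GP m : dvd_pairing G ((m %/ p ^ b)`!)`_p ((1 + 'X) ^+ m).
  (* Substituting [-X] moves the sign [(-1)^k] from the sequence to the polynomial, turning [1 + X]
     into [1 - X]. *)
  move=> Q; rewrite -pairing_compNX rmorphM rmorphXn rmorphD rmorph1 /=.
  rewrite comp_polyX.
  exact: dvd_pairing_residue_power.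
have q_gt0 : (0 < p ^ b)%N by rewrite expn_gt0 p_gt0.
have /dvd_pairing_self/dvdzP[c] := dvd_pairing_decim_sub p _ n G hp q_gt0 GP.
rewrite linearB -/A /= => eD.
have coefA k : A`_k = 'C(p * n, p * k)%:Z.
  by rewrite coef_decim // addn0 coef_expr1DX.
under eq_bigr => k _ do rewrite pmulrn -coefA.
under [X in padic_congr _ _ _ (_ * X)]eq_bigr => k _ do
  rewrite pmulrn -coef_expr1DX.
rewrite !pairing_sum_rat //; first last.
- by apply/leq_sizeP => k lt_nk; rewrite coefA bin_small // ltn_pmul2l.
- by apply/leq_sizeP => k lt_nk; rewrite coef_expr1DX bin_small.
rewrite -/F -/G.
set N := (n %/ p ^ b)`! in eD *.
have N_gt0 : (0 < N)%N := fact_gt0 _.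
(* Only the p-part of [N] is cancelled; its prime-to-p part stays as a harmless denominator. *)
exists (c%:~R / (N`_p^')%N%:R).
  by apply: padic_int_div; rewrite ?part_gt0 // -p'natE // part_pnat.
rewrite -mulrBr -rmorphB /= eD -{1}(partnC p N_gt0).
have h1 : (N`_p)%N%:R != 0 :> rat by rewrite pnatr_eq0 -lt0n part_gt0.
have h2 : (N`_p^')%N%:R != 0 :> rat by rewrite pnatr_eq0 -lt0n part_gt0.
rewrite natrM intrM /= -pmulrn natrM natrX; field.
by rewrite h1 h2.
Qed.
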